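(* Let $G\subset \mathrm{GL}(n,\mathbb{R})$ be a solvable real algebraic group whose eigenvalues are all real (that is, every eigenvalue of every element of $G$ is real). If $G^{\mathbb{C}}$ operates algebraically on a complex variety $V$, and some $G$-orbit in $V$ is compact (in the Euclidean topology), then this orbit is a point.
   Context: A connected (Lie) subgroup $G\subset \mathrm{GL}(n,\mathbb{R})$ with Lie algebra $\mathfrak{g}=\mathrm{Lie}(G)$ is called a real algebraic group if the connected subgroup of $\mathrm{GL}(n,\mathbb{C})$ with Lie algebra $\mathfrak{g}+\sqrt{-1}\cdot\mathfrak{g}$ is an algebraic subgroup of $\mathrm{GL}(n,\mathbb{C})$; this connected subgroup of $\mathrm{GL}(n,\mathbb{C})$ is called the complexification of $G$ and is denoted $G^{\mathbb{C}}$. In particular, real algebraic groups are connected by definition. The group $G$ acts on $V$ by restriction of the action of $G^{\mathbb{C}}$. *)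

(* Defs.v *)
From HB Require Import structures.
From mathcomp Require Import all_boot all_order all_algebra.
From mathcomp Require Import all_classical all_reals all_analysis.
From mathcomp Require Import complex.
(* Not imported: its notations clash with those of MathComp-Analysis. *)
From mathcomp Require mpoly.

Set Implicit Arguments.
Unset Strict Implicit.
Unset Printing Implicit Defensive.

Import Order.TTheory GRing.Theory Num.Theory.
Import numFieldNormedType.Exports.

Local Open Scope classical_set_scope.
Local Open Scope ring_scope.

(* The libraries put no topology on R[i]; this is the one given by its norm. *)
HB.instance Definition _ (R : rcfType) := PseudoPointedMetric.copy R[i] R[i]^o.
HB.instance Definition _ (R : rcfType) := NormedModule.copy R[i] R[i]^o.

Section MatrixGroups.

Definition mx_subgroup (K : fieldType) (n : nat) (H : set 'M[K]_n) : Prop :=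
  [/\ H `<=` [set A | A \in unitmx], H 1%:M,
      forall A B, H A -> H B -> H (A *m B)
    & forall A, H A -> H (invmx A)].

Definition generated_mx_subgroup (K : fieldType) (n : nat) (S : set 'M[K]_n) :
  set 'M[K]_n := smallest (@mx_subgroup K n) S.

Definition derived_mx_subgroup (K : fieldType) (n : nat) (H : set 'M[K]_n) :
    set 'M[K]_n :=
  generated_mx_subgroup
    [set C | exists A B,
       [/\ H A, H B & C = A *m B *m invmx A *m invmx B]].

Definition solvable_mx_group (K : fieldType) (n : nat) (H : set 'M[K]_n) : Prop :=
  exists k : nat, iter k (@derived_mx_subgroup K n) H = [set 1%:M].

Definition mexp (K : numFieldType) (n : nat) (A : 'M[K]_n) : 'M[K]_n :=
  limn (series (fun k : nat => (k`!%:R)^-1 *: A ^+ k)).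

End MatrixGroups.

(* In this section [iota] embeds the reals R into the field K of matrix
   entries, so that GL(n,R) (K = R) and GL(n,C) (K = R[i]) are both treated as
   real Lie groups. *)
Section LieSubgroups.
Variables (R : realType) (K : numFieldType) (iota : R -> K) (n : nat).

Definition lie_subalgebra (g : set 'M[K]_n) : Prop :=
  [/\ g 0, forall X Y, g X -> g Y -> g (X + Y),
      forall (t : R) X, g X -> g (iota t *: X)
    & forall X Y, g X -> g Y -> g (X *m Y - Y *m X)].

Definition lie_algebra (H : set 'M[K]_n) : set 'M[K]_n :=
  [set X | forall t : R, H (mexp (iota t *: X))].

(* A connected Lie subgroup need not be closed in GL(n,K): the definition is
   the standard one through one-parameter subgroups, as in B. C. Hall, Lie
   Groups, Lie Algebras, and Representations, Section 5.9. *)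
Definition connected_lie_subgroup (H : set 'M[K]_n) : Prop :=
  [/\ mx_subgroup H, lie_subalgebra (lie_algebra H)
    & H = generated_mx_subgroup [set mexp X | X in lie_algebra H]].

End LieSubgroups.

Section RealAlgebraicGroups.
Variables (R : realType) (n : nat).

Definition complex_mx (A : 'M[R]_n) : 'M[R[i]]_n := map_mx (real_complex R) A.

Definition complexified (g : set 'M[R]_n) : set 'M[R[i]]_n :=
  [set Z | exists X Y,
     [/\ g X, g Y & Z = complex_mx X + 'i *: complex_mx Y]].

Definition algebraic_subgroup (H : set 'M[R[i]]_n) : Prop :=
  mx_subgroup H /\
  exists I : set (mpoly.mpoly (n * n) R[i]),
    H = [set A | A \in unitmx /\
                 forall p, I p -> mpoly.meval (fun k => mxvec A 0 k) p = 0].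

Definition complexification (G : set 'M[R]_n) (GC : set 'M[R[i]]_n) : Prop :=
  connected_lie_subgroup (real_complex R) GC /\
  lie_algebra (real_complex R) GC = complexified (lie_algebra idfun G).

Lemma complexification_unique (G : set 'M[R]_n) (GC GC' : set 'M[R[i]]_n) :
  complexification G GC -> complexification G GC' -> GC = GC'.
Proof.
by move=> [[_ _ gGC] e] [[_ _ gGC'] e']; rewrite gGC gGC' e e'.
Qed.

Definition real_algebraic_group (G : set 'M[R]_n) : Prop :=
  connected_lie_subgroup idfun G /\
  exists2 GC, complexification G GC & algebraic_subgroup GC.

End RealAlgebraicGroups.

(* Varieties in the sense of Serre (FAC, Section 34): finitely many charts
   onto locally closed subsets of affine spaces, glued along Zariski open sets
   by regular maps, with closed diagonal. They may be reducible. *)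
Section Varieties.
Variable K : fieldType.

Definition peval (m : nat) (p : mpoly.mpoly m K) (x : 'rV[K]_m) : K :=
  mpoly.meval (fun k => x 0 k) p.

Definition zeros (m : nat) (I : set (mpoly.mpoly m K)) : set 'rV[K]_m :=
  [set x | forall p, I p -> peval p x = 0].

Definition zariski_locally_closed (m : nat) (X : set 'rV[K]_m) : Prop :=
  exists I J, X = zeros I `\` zeros J.

(* [coords i] is only meaningful on [dom i]. *)
Record atlas := Atlas {
  carrier :> Type;
  chart : finType;
  dim : chart -> nat;
  dom : chart -> set carrier;
  coords : forall i : chart, carrier -> 'rV[K]_(dim i) }.

Definition zariski_closed (V : atlas) (A : set V) : Prop :=
  forall i : chart V, exists I,
    dom i `&` A = dom i `&` @coords V i @^-1` zeros I.

Definition zariski_open (V : atlas) (U : set V) : Prop := zariski_closed (~` U).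

(* [f] is regular on [A] in the coordinates [c]. *)
Definition regular_on (T : Type) (m : nat) (c : T -> 'rV[K]_m) (A : set T)
    (f : T -> K) : Prop :=
  forall x, A x -> exists P Q : mpoly.mpoly m K,
    peval Q (c x) != 0 /\
    forall y, A y -> peval Q (c y) != 0 -> f y = peval P (c y) / peval Q (c y).

Definition morphism (V W : atlas) (f : V -> W) : Prop :=
  forall j : chart W, zariski_open (f @^-1` dom j) /\
    forall (i : chart V) (k : 'I_(dim j)),
      regular_on (@coords V i) (dom i `&` f @^-1` dom j)
        (fun x => coords j (f x) 0 k).

Definition prod_atlas (V W : atlas) : atlas :=
  @Atlas (V * W)%type (chart V * chart W)%type
    (fun ij => (dim ij.1 + dim ij.2)%N)
    (fun ij => dom ij.1 `*` dom ij.2)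
    (fun ij x => row_mx (coords ij.1 x.1) (coords ij.2 x.2)).

(* [morphism id] says that charts overlap in open sets and that the coordinate
   changes are regular. *)
Definition variety (V : atlas) : Prop :=
  [/\ \bigcup_i @dom V i = setT,
      forall i, set_inj (dom i) (@coords V i),
      forall i, zariski_locally_closed (@coords V i @` dom i),
      morphism (id : V -> V)
    & zariski_closed ([set p | p.1 = p.2] : set (prod_atlas V V))].

Definition mx_atlas (n : nat) (H : set 'M[K]_n) : atlas :=
  @Atlas (set_type H) unit (fun=> (n * n)%N) (fun=> setT)
    (fun _ A => mxvec (\val A)).

(* Only the values [act A] with [A] in [H] are relevant. *)
Definition algebraic_action (n : nat) (H : set 'M[K]_n) (V : atlas)
    (act : 'M[K]_n -> V -> V) : Prop :=
  [/\ forall x, act 1%:M x = x,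
      forall A B x, H A -> H B -> act (A *m B) x = act A (act B x)
    & @morphism (prod_atlas (mx_atlas H) V) V (fun p => act (\val p.1) p.2)].

End Varieties.

Section EuclideanTopology.
Variables (R : realType) (V : atlas R[i]).

Definition euclidean : Type := carrier V.

HB.instance Definition _ := gen_eqMixin euclidean.
HB.instance Definition _ := gen_choiceMixin euclidean.

Definition euclidean_open (U : set euclidean) : Prop :=
  forall i : chart V, exists2 O : set 'rV[R[i]]_(dim i), open O &
    dom i `&` U = dom i `&` @coords _ V i @^-1` O.

Let euclidean_openT : euclidean_open setT.
Proof. by move=> i; exists setT; [exact: openT | rewrite preimage_setT]. Qed.

Let euclidean_openI : setI_closed euclidean_open.
Proof.
move=> A B oA oB i; have [W oW eW] := oA i; have [P oP eP] := oB i.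
exists (W `&` P); first exact: openI.
by rewrite preimage_setI (setIIr _ A) (setIIr (dom i)) eW eP.
Qed.

Let euclidean_open_bigU (I : Type) (f : I -> set euclidean) :
  (forall j, euclidean_open (f j)) -> euclidean_open (\bigcup_j f j).
Proof.
move=> fo i; have /choice [W WP] : forall j, exists W : set 'rV[R[i]]_(dim i),
    open W /\ dom i `&` f j = dom i `&` @coords _ V i @^-1` W.
  by move=> j; have [W oW eW] := fo j i; exists W.
exists (\bigcup_j W j); first by apply: bigcup_open => j _; exact: (WP j).1.
rewrite preimage_bigcup !setI_bigcupr; apply: eq_bigcupr => j _.
exact: (WP j).2.
Qed.

HB.instance Definition _ := isOpenTopological.Build euclidean
  euclidean_openT euclidean_openI euclidean_open_bigU.

End EuclideanTopology.

Definition action_orbit (R : realType) (n : nat) (X : Type)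
    (act : 'M[R[i]]_n -> X -> X) (G : set 'M[R]_n) (v : X) : set X :=
  [set act (complex_mx A) v | A in G].

(* Main.v *)
Require Import Defs.
From mathcomp Require Import all_boot all_order all_algebra.
From mathcomp Require Import all_classical all_reals all_analysis.
From mathcomp Require Import complex ring.
From mathcomp Require mpoly.

(** The idea is that an element A of G has no oscillation, so that every orbit
of the powers of A inside a compact set converges, and to a fixed point of A.

No oscillation. The eigenvalues of A are real, and even positive, because A is
joined to the identity inside G and an eigenvalue cannot cross 0 on the way
([positive_spectrum]). By Cayley-Hamilton, the entries of A ^+ k, as sequences
in k, are annihilated by products of operators S - a, where S is the shift and
a > 0 ([pow_posrec]). Such sequences form an algebra, and each of them is
either identically zero or eventually of constant strict sign
([posrec_sign]), by a discrete form of Rolle's argument.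

Convergence. Let the points A ^+ k x stay in a compact set, and let w be a
cluster point. Being in a chart around w amounts to the non-vanishing of some
polynomial in the entries of A ^+ k, and a coordinate of A ^+ k x is locally a
quotient of two such polynomials. By constancy of signs, what happens for infinitely
many k happens for all large k; hence A ^+ k x converges to w
([power_orbit_cvg]), and w is fixed by A because the Euclidean topology of a
variety is Hausdorff and A acts continuously.

Induction along the derived series. Let K be the compact orbit and let M be a
term of the derived series whose derived subgroup acts trivially on K. The
elements of M commute on K, so limits of the above kind can be taken one after
the other, and finitely many elements of M have a common fixed point in K;
by compactness the whole of M has one ([common_fixpoint]). As M is normal in G
and G is transitive on K, it acts trivially on K. The series ends at the
trivial group, so one climbs back to G itself, which therefore fixes its
orbit pointwise. *)

Set Implicit Arguments.
Unset Strict Implicit.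
Unset Printing Implicit Defensive.

Import Order.TTheory GRing.Theory Num.Theory.
Import numFieldNormedType.Exports.

Local Open Scope classical_set_scope.
Local Open Scope ring_scope.

(** * Linear recurrences with positive roots *)

Section PositiveRecurrences.
Variable R : realFieldType.
Implicit Types (u v w : nat -> R).

(** These are the combinations of the sequences P(k) * a ^+ k with a > 0 and P
a polynomial. Peeling off one operator S - a at a time makes both the closure
properties and the sign lemma plain inductions, with no normal form to
maintain. *)
Inductive posrec : (nat -> R) -> Prop :=
| posrec0 u : (forall k, u k = 0) -> posrec u
| posrecS a u : 0 < a -> posrec (fun k => u k.+1 - a * u k) -> posrec u.

Lemma posrec_ext u v : u =1 v -> posrec u -> posrec v.
Proof. by move=> /funext ->. Qed.

(** Operators in the shift commute with one another, so they preserve the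
property of being annihilated by a given product. *)
Lemma posrec_shift a b u : posrec u -> posrec (fun k => a * u k.+1 + b * u k).
Proof.
elim=> [{}u u0|c {}u c0 _ IH].
  by apply: posrec0 => k; rewrite !u0 !mulr0 addr0.
by apply: (posrecS c0); apply: posrec_ext IH => k; ring.
Qed.

Lemma posrecD u v : posrec u -> posrec v -> posrec (fun k => u k + v k).
Proof.
move=> ru; elim: ru v => [{}u u0|a {}u a0 _ IH] v rv.
  by apply: posrec_ext rv => k; rewrite u0 add0r.
apply: (posrecS a0); apply: posrec_ext (IH _ (posrec_shift 1 (- a) rv)) => k.
by ring.
Qed.

(** The twisted Leibniz rule
S(uv) - ab uv = ((S - a)u) (Sv) + a u ((S - b)v)
expresses the left-hand side through products that are smaller for one of the
two inductions. *)
Lemma posrecM u v : posrec u -> posrec v -> posrec (fun k => u k * v k).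
Proof.
move=> ru; elim: ru v => [{}u u0|a {}u a0 ru IHu] v rv.
  by apply: posrec0 => k; rewrite u0 mul0r.
have {}ru : posrec u by exact: posrecS ru.
elim: rv => [{}v v0|b {}v b0 rv IHv].
  by apply: posrec0 => k; rewrite v0 mulr0.
have {}rv : posrec v by exact: posrecS rv.
apply: (posrecS (mulr_gt0 a0 b0)).
have Sv : posrec (fun k => v k.+1).
  by apply: posrec_ext (posrec_shift 1 0 rv) => k; ring.
have auw : posrec (fun k => a * (u k * (v k.+1 - b * v k))).
  by apply: posrec_ext (posrec_shift 0 a IHv) => k; ring.
by apply: posrec_ext (posrecD (IHu _ Sv) auw) => k; ring.
Qed.

Lemma posrec_cst c : posrec (fun=> c).
Proof. by apply: (posrecS ltr01); apply: posrec0 => k; ring. Qed.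

Lemma posrecN u : posrec u -> posrec (fun k => - u k).
Proof. by move=> /(posrec_shift 0 (-1)); apply: posrec_ext => k; ring. Qed.

(** The hypothesis says that u k / a ^+ k increases from N on: once
non-negative, it stays positive. *)
Lemma eventually_signed u a N : 0 < a ->
    (forall k, (N <= k)%N -> 0 < u k.+1 - a * u k) ->
  exists N', (forall k, (N' <= k)%N -> 0 < u k) \/
             (forall k, (N' <= k)%N -> u k < 0).
Proof.
move=> a0 Du; have [[k0 Nk0 u0]|nu] :=
  pselect (exists2 k, (N <= k)%N & 0 <= u k); last first.
  by exists N; right=> k Nk; rewrite ltNge; apply/negP => uk; apply: nu; exists k.
exists k0.+1; left=> k; elim: k => // k IH; rewrite ltnS => k0k.
have := Du _ (leq_trans Nk0 k0k).
have : 0 <= u k.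
  by move: k0k; rewrite leq_eqVlt => /predU1P[<-//|/IH/ltW].
by move=> uk; rewrite subr_gt0; apply: le_lt_trans; rewrite mulr_ge0 // ltW.
Qed.

(** If (S - a) u has eventually constant sign, then u k / a ^+ k is eventually
strictly monotone. *)
Lemma posrec_sign u : posrec u -> (forall k, u k = 0) \/
  exists N, (forall k, (N <= k)%N -> 0 < u k) \/
            (forall k, (N <= k)%N -> u k < 0).
Proof.
elim=> [{}u u0|a {}u a0 _ [Du0|[N [Du|Du]]]]; first by left.
- have uE k : u k = a ^+ k * u 0%N.
    elim: k => [|k IH]; first by rewrite expr0 mul1r.
    by have /eqP := Du0 k; rewrite subr_eq0 => /eqP ->; rewrite IH exprS mulrA.
  have [u00|u00|u00] := ltrgtP (u 0%N) 0.
  + by right; exists 0%N; right=> k _; rewrite uE pmulr_rlt0 // exprn_gt0.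
  + by right; exists 0%N; left=> k _; rewrite uE mulr_gt0 // exprn_gt0.
  + by left=> k; rewrite uE u00 mulr0.
- by right; exact: (eventually_signed a0 Du).
- right; have [|N' [H|H]] := @eventually_signed (fun k => - u k) a N a0.
  + by move=> k /Du; rewrite mulrN opprK -oppr_gt0 opprB addrC.
  + by exists N'; right=> k /H; rewrite oppr_gt0.
  + by exists N'; left=> k /H; rewrite oppr_lt0.
Qed.

End PositiveRecurrences.

(** * Complex sequences and powers of matrices *)

Section ComplexRecurrences.
Variable R : rcfType.
Implicit Types (u w : nat -> R[i]).

(** Real and imaginary parts are considered separately, since signs are what
matters. *)
Definition cposrec u : Prop :=
  posrec (fun k => complex.Re (u k)) /\ posrec (fun k => complex.Im (u k)).

Lemma cposrec_cst c : cposrec (fun=> c).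
Proof. by split; exact: posrec_cst. Qed.

Lemma cposrec_real (x : nat -> R) : posrec x -> cposrec (fun k => real_complex R (x k)).
Proof. by split=> //; exact: posrec_cst. Qed.

Lemma cposrecD u w : cposrec u -> cposrec w -> cposrec (fun k => u k + w k).
Proof.
move=> [ur ui] [wr wi]; split.
  by apply: posrec_ext (posrecD ur wr) => k; case: (u k); case: (w k).
by apply: posrec_ext (posrecD ui wi) => k; case: (u k); case: (w k).
Qed.

Lemma cposrecM u w : cposrec u -> cposrec w -> cposrec (fun k => u k * w k).
Proof.
move=> [ur ui] [wr wi]; split.
  apply: posrec_ext (posrecD (posrecM ur wr) (posrecN (posrecM ui wi))) => k.
  by case: (u k); case: (w k).
apply: posrec_ext (posrecD (posrecM ur wi) (posrecM ui wr)) => k.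
by case: (u k); case: (w k).
Qed.

Lemma cposrec_sum (I : Type) (s : seq I) (F : I -> nat -> R[i]) :
  (forall i, cposrec (F i)) -> cposrec (fun k => \sum_(i <- s) F i k).
Proof.
move=> FP; elim: s => [|i s IH].
  by under eq_fun do rewrite big_nil; exact: cposrec_cst.
by under eq_fun do rewrite big_cons; exact: cposrecD.
Qed.

Lemma cposrec_prod (I : Type) (s : seq I) (F : I -> nat -> R[i]) :
  (forall i, cposrec (F i)) -> cposrec (fun k => \prod_(i <- s) F i k).
Proof.
move=> FP; elim: s => [|i s IH].
  by under eq_fun do rewrite big_nil; exact: cposrec_cst.
by under eq_fun do rewrite big_cons; exact: cposrecM.
Qed.

Lemma cposrecX u j : cposrec u -> cposrec (fun k => u k ^+ j).
Proof.
move=> ru; elim: j => [|j IH]; first exact: cposrec_cst.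
by under eq_fun do rewrite exprS; exact: cposrecM.
Qed.

Lemma cposrec_peval m (p : mpoly.mpoly m R[i]) (c : nat -> 'rV[R[i]]_m) :
  (forall i, cposrec (fun k => c k 0 i)) -> cposrec (fun k => peval p (c k)).
Proof.
move=> cP; rewrite /peval; under eq_fun do rewrite mpoly.mevalE.
apply: cposrec_sum => a; apply: cposrecM; first exact: cposrec_cst.
by apply: cposrec_prod => i; exact: cposrecX.
Qed.

(** The squared modulus as an element of R, so that [posrec_sign] applies to
comparisons of moduli. *)
Definition normsq (z : R[i]) : R := complex.Re z ^+ 2 + complex.Im z ^+ 2.

Lemma normsqE z : real_complex R (normsq z) = `|z| ^+ 2.
Proof. exact: add_Re2_Im2. Qed.

Lemma normsq_gt0 z : (0 < normsq z) = (z != 0).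
Proof.
rewrite -ltcR normsqE rmorph0; have [->|z0] := eqVneq z 0.
  by rewrite normr0 expr0n ltxx.
by rewrite exprn_gt0 // normr_gt0.
Qed.

Lemma posrec_normsq u : cposrec u -> posrec (fun k => normsq (u k)).
Proof. by move=> [ur ui]; exact: posrecD (posrecM _ _) (posrecM _ _). Qed.

Lemma cposrec_neq0 w k0 : cposrec w -> w k0 != 0 -> \forall k \near \oo, w k != 0.
Proof.
rewrite -normsq_gt0 => /posrec_normsq /posrec_sign [->|]; first by rewrite ltxx.
move=> [N [H|H]] _; exists N => // k /= Nk; first by rewrite -normsq_gt0 H.
by have := H _ Nk; rewrite ltNge addr_ge0 // sqr_ge0.
Qed.

(** An inequality between moduli that holds infinitely often holds eventually:
the difference of the squared moduli has eventually constant sign. This is how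
a cluster value of the quotient u / w is turned into its limit. *)
Lemma cposrec_dominated u w (e : R) : 0 < e -> cposrec u -> cposrec w ->
    (forall N, exists2 k, (N <= k)%N & `|u k| <= real_complex R e * `|w k|) ->
  \forall k \near \oo, `|u k| <= real_complex R e * `|w k|.
Proof.
move=> e0 ru rw uw.
have leE k : (`|u k| <= real_complex R e * `|w k|) =
    (normsq (u k) - e ^+ 2 * normsq (w k) <= 0).
  rewrite subr_le0 -lecR rmorphM rmorphXn /= !normsqE -exprMn.
  by rewrite ler_pXn2r // nnegrE mulr_ge0 // ler0c ltW.
have /posrec_sign [H|[N [H|H]]] :
    posrec (fun k => normsq (u k) - e ^+ 2 * normsq (w k)).
- apply: posrecD (posrec_normsq ru) _; apply: posrecN.
  by apply: posrecM (posrec_normsq rw); exact: posrec_cst.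
- by exists 0%N => // k _ /=; rewrite leE H.
- by have [k Nk] := uw N; rewrite leE leNgt H.
- by exists N => // k /= Nk; rewrite leE ltW // H.
Qed.

End ComplexRecurrences.

Section MatrixPowers.
Variable R : rcfType.

(** The factor B lets the product be consumed from the left: applying S - a to
B A ^+ k replaces B by B (A - a). *)
Lemma mul_pow_posrec n (A B : 'M[R]_n.+1) (s : seq R) :
    all (fun a => 0 < a) s -> B * \prod_(a <- s) (A - a%:M) = 0 ->
  forall i j, posrec (fun k => (B *m (A ^+ k)) i j).
Proof.
elim: s B => [|a s IH] B /=.
  by rewrite big_nil mulr1 => _ -> i j; apply: posrec0 => k; rewrite mul0mx mxE.
move=> /andP[a0 s0]; rewrite big_cons mulrA => /(IH _ s0) H i j.
apply: (posrecS a0); apply: posrec_ext (H i j) => k.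
rewrite exprS -!mulmxE mulmxBr mulmxBl mul_mx_scalar -scalemxAl mulmxA.
by rewrite !mxE.
Qed.

Lemma map_prod_XsubC (s : seq R) :
  map_poly (real_complex R) (\prod_(a <- s) ('X - a%:P)) =
  \prod_(a <- s) ('X - (real_complex R a)%:P).
Proof.
rewrite rmorph_prod; apply: eq_bigr => a _.
by rewrite rmorphB /= map_polyX map_polyC.
Qed.

Definition real_spectrum n (A : 'M[R]_n) : Prop :=
  forall a, eigenvalue (map_mx (real_complex R) A) a -> a \is Num.real.

Lemma real_spectrum_factor n (A : 'M[R]_n) : real_spectrum A ->
  exists s, char_poly A = \prod_(a <- s) ('X - a%:P).
Proof.
move=> Areal.
have [r] := closed_field_poly_normal (char_poly (map_mx (real_complex R) A)).
rewrite (monicP (char_poly_monic _)) scale1r => rE; exists (map (@complex.Re R) r).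
apply: (map_poly_inj (real_complex R)).
rewrite map_char_poly rE map_prod_XsubC big_map.
apply: eq_big_seq => z zr.
rewrite [real_complex R (complex.Re z)]RRe_real //; apply: Areal.
by rewrite eigenvalue_root_char rE root_prod_XsubC.
Qed.

Lemma pow_posrec n (A : 'M[R]_n) (s : seq R) : all (fun a => 0 < a) s ->
    char_poly A = \prod_(a <- s) ('X - a%:P) ->
  forall i j, posrec (fun k => (A ^+ k) i j).
Proof.
case: n A => [|n] A s0 AE i j; first by case: i.
have H : 1%:M * \prod_(a <- s) (A - a%:M) = 0.
  rewrite mul1r -[RHS](Cayley_Hamilton A) AE rmorph_prod /=.
  by apply: eq_bigr => a _; rewrite rmorphB /= horner_mx_X horner_mx_C.
by apply: posrec_ext (mul_pow_posrec s0 H i j) => k; rewrite mul1mx.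
Qed.

End MatrixPowers.

(** * The matrix exponential *)

Section MatrixExponential.
Variable R : realType.

(** Convergence of matrices is entrywise, by definition of the neighbourhoods. *)
Lemma cvg_mx (K : topologicalType) (T : Type) (F : set_system T) m n
    (f : T -> 'M[K]_(m, n)) (M : 'M[K]_(m, n)) : Filter F ->
  (forall i j, f t i j @[t --> F] --> M i j) -> f t @[t --> F] --> M.
Proof.
move=> FF fM A [P MP PA]; apply: (filterS (P := fun t => forall i j, P i j (f t i j))).
  by move=> t Pt; apply: PA.
by do 2!apply: filter_forall => ?; exact/fM/MP.
Qed.

(** A growth condition that gives infinite radius of convergence and is stable
under term by term differentiation. *)
Definition factorially_bounded (c : nat -> R) : Prop :=
  exists D C : R, forall k, `|c k| <= D * (C ^+ k / k`!%:R).

Lemma cvg_pseries_factorially_bounded (c : nat -> R) (x : R) :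
  factorially_bounded c -> cvgn (pseries c x).
Proof.
move=> [D [C cDC]]; apply: normed_cvg; rewrite /normed_series_of /=.
have ck k : `|c k * x ^+ k| <= D * exp_coeff (C * `|x|) k.
  by rewrite normrM normrX /exp_coeff /= exprMn mulrAC mulrA ler_wpM2r // exprn_ge0.
apply: (@series_le_cvg _ _ (fun k => D * exp_coeff (C * `|x|) k)) => //.
  by move=> k; apply: le_trans (ck k).
exact: (is_cvg_seriesZ (k := D) (is_cvg_series_exp_coeff (C * `|x|))).
Qed.

Lemma factorially_bounded_diffs (c : nat -> R) :
  factorially_bounded c -> factorially_bounded (pseries_diffs c).
Proof.
move=> [D [C cDC]]; exists (D * C), C => k; rewrite /pseries_diffs normrM normr_nat.
apply: le_trans (ler_wpM2l _ (cDC k.+1)) _ => //.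
rewrite factS natrM invfM exprS [leLHS](_ : _ = D * C * (C ^+ k / k`!%:R)) //.
have k0 : k`!%:R != 0 :> R by rewrite pnatr_eq0 -lt0n fact_gt0.
have k1 : k.+1%:R != 0 :> R by rewrite pnatr_eq0.
by field; rewrite ?nat1r ?natr1 k0 k1.
Qed.

Lemma continuous_pseries (c : nat -> R) :
  factorially_bounded c -> continuous (fun x : R => limn (pseries c x)).
Proof.
move=> cb x; apply: differentiable_continuous; apply/derivable1_diffP.
have cv d : factorially_bounded d -> cvgn (pseries d (`|x| + 1)).
  exact: cvg_pseries_factorially_bounded.
have := @pseries_snd_diffs R c (`|x| + 1) x (cv _ cb)
  (cv _ (factorially_bounded_diffs cb))
  (cv _ (factorially_bounded_diffs (factorially_bounded_diffs cb))) _.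
have -> : `|x| < `| `|x| + 1 | by rewrite [ltRHS]ger0_norm ?ltrDl // addr_ge0.
by move=> /(_ isT) [].
Qed.

Lemma factorially_bounded_pow n (X : 'M[R]_n) i j :
  factorially_bounded (fun k => (k`!%:R)^-1 * (X ^+ k) i j).
Proof.
pose C := \sum_a \sum_b `|X a b|.
have C0 : 0 <= C by apply: sumr_ge0 => a _; apply: sumr_ge0.
have XC k a b : `|(X ^+ k) a b| <= C ^+ k.
  elim: k a b => [|k IH] a b.
    by rewrite !expr0 mxE; case: (a == b); rewrite ?normr1 // normr0.
  rewrite exprS -mulmxE mxE (le_trans (ler_norm_sum _ _ _)) //.
  apply: (@le_trans _ _ (\sum_l `|X a l| * C ^+ k)).
    by apply: ler_sum => l _; rewrite normrM ler_wpM2l.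
  rewrite -mulr_suml exprS ler_wpM2r ?exprn_ge0 //.
  rewrite [leRHS](bigD1 a) //= lerDl; apply: sumr_ge0 => ? _; exact: sumr_ge0.
exists 1, C => k; rewrite mul1r normrM [leRHS]mulrC ger0_norm ?invr_ge0 //.
by rewrite ler_wpM2l ?invr_ge0.
Qed.

(** Since the exponential is defined as a limit, which has a default value when
it does not exist, nothing can be said about it before convergence is known. *)
Lemma mexp_cvg n (X : 'M[R]_n) :
  series (fun k => (k`!%:R)^-1 *: X ^+ k) @ \oo --> mexp X.
Proof.
pose c i j k : R := (k`!%:R)^-1 * (X ^+ k) i j.
suff: series (fun k => (k`!%:R)^-1 *: X ^+ k) @ \oo -->
    \matrix_(i, j) limn (series (c i j)).
  by move=> /[dup] /cvgP.
apply: cvg_mx => i j; rewrite mxE.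
rewrite (_ : (fun t => _) = series (c i j)); last first.
  by apply/funext => N; rewrite /series /= summxE; apply: eq_bigr => k _; rewrite mxE.
have := cvg_pseries_factorially_bounded (x := 1) (factorially_bounded_pow X i j).
rewrite /pseries (_ : (fun k => _ * _) = c i j) //.
by apply/funext => k; rewrite expr1n mulr1.
Qed.

Lemma exp_scalemx (K : comPzRingType) n (t : K) (X : 'M[K]_n) k :
  (t *: X) ^+ k = t ^+ k *: X ^+ k.
Proof.
elim: k => [|k IH]; first by rewrite !expr0 scale1r.
by rewrite !exprS IH -!mulmxE -scalemxAl -scalemxAr scalerA.
Qed.

Lemma mexpE n (X : 'M[R]_n) i j t :
  mexp (t *: X) i j = limn (pseries (fun k => (k`!%:R)^-1 * (X ^+ k) i j) t).
Proof.
apply/esym/cvg_lim => //.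
have H : series (fun k => (k`!%:R)^-1 *: (t *: X) ^+ k) N i j @[N --> \oo] -->
    mexp (t *: X) i j.
  exact: continuous_cvg (@coord_continuous R n n i j (mexp (t *: X)))
    (@mexp_cvg n (t *: X)).
rewrite [X in X @ _ --> _](_ : _ = fun N =>
  series (fun k => (k`!%:R)^-1 *: (t *: X) ^+ k) N i j) //.
apply/funext => N.
rewrite /pseries /series /= summxE; apply: eq_bigr => k _.
by rewrite exp_scalemx !mxE mulrCA mulrC.
Qed.

Lemma mexp_entry_continuous n (X : 'M[R]_n) i j :
  continuous (fun t : R => mexp (t *: X) i j).
Proof.
under eq_fun do rewrite mexpE.
exact: continuous_pseries (factorially_bounded_pow X i j).
Qed.

Lemma mexp0 n : mexp 0 = 1%:M :> 'M[R]_n.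
Proof.
apply: cvg_lim => //; rewrite -cvg_shiftS; apply: cvg_near_cst.
near=> N; rewrite /series /= big_nat_recl // big1 ?addr0.
  by rewrite expr0 fact0 invr1 scale1r.
by move=> k _; rewrite expr0n scaler0.
Unshelve. all: by end_near. Qed.

Lemma real_complex_continuous : continuous (real_complex R : R -> R[i]).
Proof.
move=> x; apply/cvgrPdist_lt => e e0.
have eR : (complex.Re e)%:C%C = e by apply: RRe_real; exact: gtr0_real.
have e'0 : 0 < complex.Re e by rewrite -ltcR eR.
near=> y; rewrite -rmorphB /= normc_def /= expr0n /= addr0 sqrtr_sqr -eR ltcR.
near: y; exact: (cvgrPdist_lt _ _).1.
Unshelve. all: by end_near. Qed.

Lemma mexp_complex n (X : 'M[R]_n) : mexp (complex_mx X) = complex_mx (mexp X).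
Proof.
apply: cvg_lim; first exact: (@norm_hausdorff R[i] ).
rewrite (_ : series _ = fun N => complex_mx (series (fun k => (k`!%:R)^-1 *: X ^+ k) N)).
  apply: cvg_mx => i j; rewrite mxE.
  under eq_fun do rewrite mxE.
  apply: continuous_cvg; first exact: real_complex_continuous.
  exact: continuous_cvg (@coord_continuous R n n i j (mexp X)) (@mexp_cvg n X).
apply/funext => N; rewrite /series /= /complex_mx raddf_sum; apply: eq_bigr => k _ /=.
by rewrite map_mxZ fmorphV rmorph_nat rmorphXn.
Qed.

End MatrixExponential.

(** * Positivity of the spectrum along paths *)

Section PositiveSpectrum.
Variable R : realType.

(** With the next lemma, this turns the negativity of all roots of a
real-rooted polynomial into sign conditions on the coefficients, which,
unlike the roots, visibly depend continuously on the matrix. *)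
Lemma prod_XsubC_coef_gt0 (s : seq R) : (forall b, b \in s -> b < 0) ->
  forall k, (k <= size s)%N -> 0 < (\prod_(b <- s) ('X - b%:P))`_k.
Proof.
elim: s => [|b s IH] sneg k; first by rewrite leqn0 big_nil => /eqP ->; rewrite coef1.
have {}IH := IH (fun c cs => sneg c (mem_behead (s := b :: s) cs)).
have b0 : 0 < - b by rewrite oppr_gt0 sneg ?mem_head.
rewrite big_cons; set p := \prod_(_ <- _) _ in IH *.
have p0 j : 0 <= p`_j.
  have [js|js] := leqP j (size s); first exact/ltW/IH.
  by rewrite nth_default // size_prod_XsubC.
rewrite mulrBl coefB coefXM coefCM -mulNr; case: k => [_|k ks] /=.
  by rewrite add0r mulr_gt0 // IH.
by rewrite ltr_wpDr ?IH // mulr_ge0 // ltW.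
Qed.

(** At a positive point, a monic polynomial with non-negative coefficients is
positive. *)
Lemma prod_XsubC_coef_ge0 (s : seq R) :
    (forall k, (k <= size s)%N -> 0 <= (\prod_(b <- s) ('X - b%:P))`_k) ->
  forall b, b \in s -> b <= 0.
Proof.
set p := \prod_(_ <- _) _ => p0 b bs; rewrite leNgt; apply/negP => b0.
have pb : p.[b] = 0 by apply/eqP; rewrite -rootE root_prod_XsubC.
suff : 0 < p.[b] by rewrite pb ltxx.
rewrite horner_coef size_prod_XsubC big_ord_recr /= ltr_wpDl //.
  by apply: sumr_ge0 => i _; apply: mulr_ge0; [exact/p0/ltnW|exact/exprn_ge0/ltW].
rewrite mulr_gt0 ?exprn_gt0 // lt_def p0 // andbT.
have : lead_coef p != 0 by rewrite lead_coef_eq0 monic_neq0 // monic_prod_XsubC.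
by rewrite lead_coefE size_prod_XsubC.
Qed.

Definition coef_continuous (f : R -> {poly R}) : Prop :=
  forall k, continuous (fun t => (f t)`_k).

Lemma continuous_sum (I : Type) (r : seq I) (P : pred I) (f : I -> R -> R) :
  (forall i, continuous (f i)) -> continuous (fun t => \sum_(i <- r | P i) f i t).
Proof.
by move=> fc; apply: (continuous_big (@add_continuous R)) => i _; exact: fc.
Qed.

Lemma coef_continuous_sum (I : Type) (r : seq I) (f : I -> R -> {poly R}) :
  (forall i, coef_continuous (f i)) ->
  coef_continuous (fun t => \sum_(i <- r) f i t).
Proof.
move=> fc k; under eq_fun do rewrite coef_sum.
by apply: continuous_sum => i; exact: fc.
Qed.

Lemma coef_continuousM (f g : R -> {poly R}) :
  coef_continuous f -> coef_continuous g -> coef_continuous (fun t => f t * g t).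
Proof.
move=> fc gc k; under eq_fun do rewrite coefM.
apply: continuous_sum => i t; apply: cvgM; [exact: fc|exact: gc].
Qed.

Lemma coef_continuous_prod (I : Type) (r : seq I) (f : I -> R -> {poly R}) :
  (forall i, coef_continuous (f i)) ->
  coef_continuous (fun t => \prod_(i <- r) f i t).
Proof.
move=> fc; elim: r => [|i r IH].
  by under eq_fun do rewrite big_nil; move=> k t; exact: cvg_cst.
by under eq_fun do rewrite big_cons; exact: coef_continuousM.
Qed.

Lemma char_poly_continuous n (g : R -> 'M[R]_n) :
  (forall i j, continuous (fun t => g t i j)) ->
  coef_continuous (fun t => char_poly (g t)).
Proof.
move=> gc; rewrite /char_poly /determinant; apply: coef_continuous_sum => s.
apply: coef_continuousM; first by move=> k t; exact: cvg_cst.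
apply: coef_continuous_prod => i k; under eq_fun do rewrite !mxE coefB coefC.
move=> t; apply: cvgB; first exact: cvg_cst.
by case: (k == 0)%N; [exact: gc|exact: cvg_cst].
Qed.

Lemma eigenvalueN (K : fieldType) n (A : 'M[K]_n) a :
  eigenvalue (- A) a = eigenvalue A (- a).
Proof.
apply/eigenvalueP/eigenvalueP => -[v vA v0]; exists v => //.
  by rewrite scaleNr -vA mulmxN opprK.
by rewrite mulmxN vA scaleNr opprK.
Qed.

Lemma real_spectrumN n (A : 'M[R]_n) : real_spectrum A -> real_spectrum (- A).
Proof.
by move=> Areal a; rewrite raddfN eigenvalueN => /Areal; rewrite realN.
Qed.

(** Consider the times at which all coefficients of the characteristic
polynomial of - g t are positive. They form an open set by continuity; and also
a closed one, because for a real-rooted polynomial without root 0 it is enough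
that the coefficients be non-negative. The time 0 belongs to it, so all do. *)
Lemma positive_spectrum n (g : R -> 'M[R]_n) :
    (forall i j, continuous (fun t => g t i j)) -> g 0 = 1%:M ->
    (forall t, g t \in unitmx) -> (forall t, real_spectrum (g t)) ->
  forall t, exists2 s, all (fun a => 0 < a) s &
    char_poly (g t) = \prod_(a <- s) ('X - a%:P).
Proof.
move=> gc g0 gu greal.
pose f (k : 'I_n.+1) t := (char_poly (- g t))`_k.
have fc k : continuous (f k).
  apply: char_poly_continuous => i j; under eq_fun do rewrite mxE.
  by move=> t; apply: cvgN; exact: gc.
have neg_coef t s : char_poly (- g t) = \prod_(b <- s) ('X - b%:P) ->
    (forall b, b \in s -> b < 0) -> forall k, 0 < f k t.
  move=> sE sneg k; rewrite /f sE; apply: prod_XsubC_coef_gt0 => //.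
  by rewrite -ltnS -(size_prod_XsubC _ id) -sE size_char_poly.
have coef_neg t s : char_poly (- g t) = \prod_(b <- s) ('X - b%:P) ->
    (forall k, 0 <= f k t) -> forall b, b \in s -> b < 0.
  move=> sE f0 b bs; rewrite lt_neqAle; apply/andP; split; last first.
    apply: prod_XsubC_coef_ge0 bs => k ks; rewrite -sE.
    have kn : (k < n.+1)%N by rewrite -(size_char_poly (- g t)) sE size_prod_XsubC.
    exact: (f0 (Ordinal kn)).
  apply/eqP => b0; move: bs; rewrite b0 -root_prod_XsubC -sE -eigenvalue_root_char.
  move=> /eigenvalueP [v]; rewrite scale0r mulmxN => /eqP; rewrite oppr_eq0 => /eqP vg.
  by rewrite -(mulmxK (gu t) v) vg mul0mx eqxx.
pose T := [set t | forall k, 0 < f k t].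
have TE : T = [set: R].
  have /connected_intervalP : is_interval [set: R] by [].
  apply.
  - exists 0 => /=; have [s sE] := real_spectrum_factor (real_spectrumN (greal 0)).
    apply: (neg_coef _ s sE) => b; rewrite -root_prod_XsubC -sE -eigenvalue_root_char.
    rewrite g0 eigenvalueN => /eigenvalueP [v]; rewrite mulmx1 => vb v0.
    have : (1 + b) *: v == 0 by rewrite scalerDl scale1r {1}vb scaleNr addNr.
    by rewrite scaler_eq0 (negbTE v0) orbF addrC addr_eq0 => /eqP ->; rewrite oppr_lt0.
  - exists T; last by rewrite setTI.
    rewrite openE => t Tt.
    apply: (@filter_forall _ _ (fun k u => 0 < f k u) (nbhs t)) => k.
    exact: (cvgr_gt (f k t) (fc k t)).
  (* Non-negativity is closed, and coef_neg makes it strict again. *)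
  - exists (\bigcap_(k in [set: 'I_n.+1]) f k @^-1` [set x | 0 <= x]).
      apply: closed_bigI => k _; apply: (@preimage_closed _ _ (f k) [set x : R | 0 <= x]).
        by move=> t _; exact: fc.
      exact: closed_ge.
    rewrite setTI; apply/seteqP; split => t Tt k => [_|]; first exact/ltW/Tt.
    have [s sE] := real_spectrum_factor (real_spectrumN (greal t)).
    by apply: (neg_coef _ s sE); apply: coef_neg sE _ => j; exact: Tt.
move=> t; have [s sE] := real_spectrum_factor (greal t); exists s => //.
apply/allP => a; rewrite -root_prod_XsubC -sE -eigenvalue_root_char => Aa.
have [r rE] := real_spectrum_factor (real_spectrumN (greal t)).
have Tt : T t by rewrite TE.
rewrite -oppr_lt0; apply: (coef_neg t r rE) => [k|]; first exact/ltW/Tt.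
by rewrite -root_prod_XsubC -rE -eigenvalue_root_char eigenvalueN opprK.
Qed.

(** The elements that can be joined to the identity form a subgroup, which
contains the exponentials. *)
Lemma connected_lie_subgroup_path n (G : set 'M[R]_n) :
    connected_lie_subgroup idfun G -> forall A, G A ->
  exists g : R -> 'M[R]_n, [/\ forall i j, continuous (fun t => g t i j),
    forall t, G (g t), g 0 = 1%:M & g 1 = A].
Proof.
move=> [[Gu G1 GM GV] [lie0 _ _ _] GE].
pose H := [set A | G A /\ exists g : R -> 'M[R]_n,
  [/\ forall i j, continuous (fun t => g t i j),
    forall t, G (g t), g 0 = 1%:M & g 1 = A]].
suff GH : G `<=` H by move=> A /GH [].
rewrite {1}GE; apply: smallest_sub.
- split.
  + by move=> A [/Gu].
  + split=> //; exists (fun=> 1%:M); split=> // i j t; exact: cvg_cst.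
  + move=> A B [GA [g [gc gG g0 g1]]] [GB [h [hc hG h0 h1]]].
    split; first exact: GM.
    exists (fun t => g t *m h t); split=> [i j| t||].
    * under eq_fun do rewrite mxE; apply: continuous_sum => k t.
      by apply: cvgM; [exact: gc|exact: hc].
    * exact: GM.
    * by rewrite g0 h0 mulmx1.
    * by rewrite g1 h1.
  + move=> A [GA [g [gc gG g0 g1]]]; split; first exact: GV.
    (* Reversing the path avoids inverting it. *)
    exists (fun t => invmx A *m g (1 - t)); split=> [i j| t||].
    * under eq_fun do rewrite mxE; apply: continuous_sum => k t.
      apply: cvgM; first exact: cvg_cst.
      apply: (cvg_comp (fun t => 1 - t) (fun t => g t k j)); last exact: gc.
      by apply: cvgB; [exact: cvg_cst|exact: cvg_id].
    * by apply: GM => //; exact: GV.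
    * by rewrite subr0 g1 mulVmx // Gu.
    * by rewrite subrr g0 mulmx1.
- move=> _ [X lX <-]; split; first by have := lX 1; rewrite scale1r.
  exists (fun t => mexp (t *: X)); split=> [i j|t||].
  + exact: mexp_entry_continuous.
  + exact: lX.
  + by rewrite scale0r mexp0.
  + by rewrite scale1r.
Qed.

End PositiveSpectrum.

(** * The Euclidean topology of a variety *)

Section VarietyTopology.
Variable R : realType.
Local Notation C := R[i].
Implicit Types V W : atlas C.

Lemma cvg_coord (T : Type) (F : set_system T) (FF : Filter F) m n (f : T -> 'M[C]_(m, n))
    (M : 'M[C]_(m, n)) i j :
  f t @[t --> F] --> M -> f t i j @[t --> F] --> M i j.
Proof. exact: continuous_cvg (@coord_continuous C m n i j M). Qed.

Lemma cvg_row_mx (T : Type) (F : set_system T) (FF : Filter F) m n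
    (f : T -> 'rV[C]_m) (g : T -> 'rV[C]_n) (a : 'rV[C]_m) (b : 'rV[C]_n) :
  f t @[t --> F] --> a -> g t @[t --> F] --> b ->
  row_mx (f t) (g t) @[t --> F] --> row_mx a b.
Proof.
move=> fa gb; apply: cvg_mx => i j; rewrite mxE; under eq_fun do rewrite mxE.
by case: (fintype.split j) => k; exact: cvg_coord.
Qed.

Lemma peval_cvg (T : Type) (F : set_system T) (FF : Filter F) m
    (p : mpoly.mpoly m C)
    (c : T -> 'rV[C]_m) (x : 'rV[C]_m) :
  c t @[t --> F] --> x -> peval p (c t) @[t --> F] --> peval p x.
Proof.
move=> cx; rewrite /peval mpoly.mevalE; under eq_fun do rewrite mpoly.mevalE.
apply: (cvg_big (@add_continuous C)) => a _.
apply: cvgM; first exact: cvg_cst.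
apply: (cvg_big (@mul_continuous C)) => i _.
elim: (mpoly.fun_of_multinom a i) => [|k IHk].
  by under eq_fun do rewrite expr0; rewrite expr0; exact: cvg_cst.
under eq_fun do rewrite exprS.
rewrite exprS.
apply: cvgM.
  exact: cvg_coord.
exact: IHk.
Qed.

Lemma peval_near_neq0 (T : Type) (F : set_system T) (FF : Filter F) m
    (p : mpoly.mpoly m C)
    (c : T -> 'rV[C]_m) (x : 'rV[C]_m) :
  c t @[t --> F] --> x -> peval p x != 0 -> \forall t \near F, peval p (c t) != 0.
Proof.
move=> /(peval_cvg FF (p := p)) px px0.
exact: (cvgr_neq0 _ px px0).
Qed.

(** Points are followed along an arbitrary filter rather than a sequence, so
that the same lemmas serve for the neighbourhood filters of the Euclidean
topology and for those read in a chart. *)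
Section Convergence.
Context (V : atlas C) (T : Type) (F : set_system T) {FF : Filter F}.
Variables (i : chart V) (y : T -> V) (x : V).
Hypothesis (xi : dom i x) (yi : \forall t \near F, dom i (y t))
  (yx : coords i (y t) @[t --> F] --> coords i x).

Lemma zariski_open_near (U : set V) :
  zariski_open U -> U x -> \forall t \near F, U (y t).
Proof.
move=> /(_ i) [I IE] Ux.
have [p Ip px] : exists2 p, I p & peval p (coords i x) != 0.
  apply: contrapT => nI; have : (dom i `&` ~` U) x.
    rewrite IE; split=> // p Ip; apply: contrapT => px; apply: nI; exists p => //.
    exact/eqP.
  by case.
near=> t; apply: contrapT => nU.
have : (dom i `&` ~` U) (y t) by split => //; near: t.
rewrite IE => -[_ /(_ _ Ip)]; apply/eqP; near: t.
exact: (peval_near_neq0 FF yx px).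
Unshelve. all: by end_near. Qed.

Lemma morphism_cvg W (f : V -> W) j : morphism f -> dom j (f x) ->
  (\forall t \near F, dom j (f (y t))) /\
  coords j (f (y t)) @[t --> F] --> coords j (f x).
Proof.
move=> /(_ j) [Uo freg] xj; have yj := zariski_open_near Uo xj.
split=> //; apply: cvg_mx => a k; rewrite (ord1 a).
have [P [Q [Qx PQ]]] := freg i k x (conj xi xj).
rewrite PQ //.
apply: cvg_trans (cvgM (peval_cvg FF (p := P) yx)
  (cvgV Qx (peval_cvg FF (p := Q) yx))).
apply: near_eq_cvg; near=> t; rewrite PQ //; first by split; near: t.
by near: t; exact: (peval_near_neq0 FF yx Qx).
Unshelve. all: by end_near. Qed.

End Convergence.

(** The neighbourhoods of x as seen in the chart i; they do not refer to the
Euclidean topology, and are used to compare two charts. *)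
Definition chart_filter V (i : chart V) (x : V) : set_system V :=
  [set B | nbhs (coords i x) [set z | forall y, dom i y -> coords i y = z -> B y]].

Lemma chart_filter_filter V (i : chart V) (x : V) : Filter (chart_filter i x).
Proof.
split; rewrite /chart_filter /=; first by apply: (@filterE _ (nbhs (coords i x))).
- by move=> A B; apply: (@filterS2 _ (nbhs (coords i x))) =>
    z Az Bz y yi yz; split; [exact: Az|exact: Bz].
- move=> A B AB; apply: (@filterS _ (nbhs (coords i x))) => z Az y yi yz.
  exact/AB/Az.
Qed.

Section Variety.
Variables (V : atlas C) (V_variety : variety V).

Lemma chart_cover (x : V) : exists i : chart V, dom i x.
Proof.
have [cov _ _ _ _] := V_variety.
by have : [set: V] x by []; rewrite -cov => -[i _ xi]; exists i.
Qed.

(** A set open in one chart is open in all of them, because the changes of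
coordinates are regular, hence continuous. *)
Lemma euclidean_chart_nbhs (i : chart V) (x : V) (O : set 'rV[C]_(Defs.dim i)) :
  dom i x -> nbhs (coords i x) O ->
  @nbhs _ (euclidean V) x (dom i `&` coords i @^-1` O).
Proof.
have [_ _ _ idm _] := V_variety => xi; rewrite nbhsE => -[W [oW xW] WO].
suff oU : @open (euclidean V) (dom i `&` coords i @^-1` W).
  apply: (filterS (P := dom i `&` coords i @^-1` W)).
    by move=> y [yi yO]; split=> //; exact: WO.
  exact: open_nbhs_nbhs.
move=> j; pose U : set V := dom i `&` coords i @^-1` W.
exists (interior [set z | forall y, dom j y -> coords j y = z -> U y]).
  exact: open_interior.
apply/seteqP; split=> y [yj yU]; split=> //; last exact: (nbhs_singleton yU).
have FF := chart_filter_filter j y.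
have [ni ci] : (\forall t \near chart_filter j y, dom i t) /\
    coords i t @[t --> chart_filter j y] --> coords i y.
  apply: (morphism_cvg yj) idm yU.1.
  - by apply: (@filterE _ (nbhs (coords j y))) => z t tj _.
  - move=> A yA; apply: (@filterS _ (nbhs (coords j y)) _ _ _ _ yA).
    by move=> z Az t tj tz /=; rewrite tz.
have : \forall t \near chart_filter j y, U t.
  apply: filterI => //; apply: ci; apply: open_nbhs_nbhs.
  by split=> //; exact: yU.2.
exact.
Qed.

Lemma euclidean_cvgP (T : Type) (F : set_system T) (FF : Filter F) (y : T -> V)
    (x : V) (i : chart V) : dom i x ->
  ((y t : euclidean V) @[t --> F] --> (x : euclidean V)) <->
  (\forall t \near F, dom i (y t)) /\ coords i (y t) @[t --> F] --> coords i x.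
Proof.
move=> xi; split=> [yx|[yi yx]].
  split=> [|A xA].
    have H : F [set t | (dom i `&` coords i @^-1` setT) (y t)].
      exact: yx _ (euclidean_chart_nbhs xi filterT).
    by apply: filterS H => t [].
  have H : F [set t | (dom i `&` coords i @^-1` A) (y t)].
    exact: yx _ (euclidean_chart_nbhs xi xA).
  by apply: (@filterS _ F _ _ _ _ H) => t [].
move=> A; rewrite nbhsE => -[B [oB xB] BA].
have [W oW OE] := oB i.
have xW : W (coords i x).
  by have : (dom i `&` B) x by []; rewrite OE => -[].
have yW : \forall t \near F, W (coords i (y t)) by apply: yx; exact: open_nbhs_nbhs.
apply: (@filterS2 _ F _ _ _ _ _ yi yW) => t ti tW; apply: BA.
by have : (dom i `&` coords i @^-1` W) (y t) by []; rewrite -OE => -[].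
Qed.

(** Off the diagonal, some polynomial equation of the diagonal fails, and it
keeps failing on a product of two neighbourhoods; these are then disjoint. *)
Lemma euclidean_hausdorff : hausdorff_space (euclidean V).
Proof.
have [_ _ _ _ diag] := V_variety => p q pq.
have [i pi] := chart_cover p; have [j qj] := chart_cover q.
have [I IE] := diag (i, j); apply: contrapT => npq.
have [P IP P0] : exists2 P, I P & peval P (row_mx (coords i p) (coords j q)) != 0.
  apply: contrapT => nI.
  have : (@dom _ (prod_atlas V V) (i, j) `&` [set p | p.1 = p.2]) (p, q).
    rewrite IE; split=> // P IP; apply: contrapT => PX; apply: nI; exists P => //.
    exact/eqP.
  by case.
have : \forall z \near (coords i p, coords j q), peval P (row_mx z.1 z.2) != 0.
  apply: (@peval_near_neq0 _ (nbhs (coords i p, coords j q)) _ _ P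
    (fun z => row_mx z.1 z.2) _ _ P0).
  by apply: cvg_row_mx; [exact: cvg_fst|exact: cvg_snd].
move=> [[A B] [/= pA qB] AB].
have [y [[yi yA] [yj yB]]] :=
  pq _ _ (euclidean_chart_nbhs pi pA) (euclidean_chart_nbhs qj qB).
have : (@dom _ (prod_atlas V V) (i, j) `&` [set p | p.1 = p.2]) (y, y) by [].
rewrite IE => -[_ /(_ _ IP)] /eqP; apply/negP.
exact: (AB (coords i y, coords j y)).
Qed.

(** The slice y |-> (A, y) is continuous in the coordinates of the product. *)
Lemma euclidean_action_continuous n (H : set 'M[C]_n) (act : 'M[C]_n -> V -> V) A :
  algebraic_action H act -> H A ->
  continuous (act A : euclidean V -> euclidean V).
Proof.
move=> [_ _ am] HA x.
have [i xi] := chart_cover x; have [j Axj] := chart_cover (act A x).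
apply/(euclidean_cvgP (@nbhs_filter (euclidean V) x) _ Axj).
have [yi yx] := (euclidean_cvgP (@nbhs_filter (euclidean V) x) id xi).1 (fun B xB => xB).
pose a : set_type H := exist _ A (mem_set HA).
have [|||Hj Hc] := @morphism_cvg (prod_atlas (mx_atlas H) V) _ (@nbhs _ (euclidean V) x) _
  (tt, i) (fun y => (a, y)) (a, x) _ _ _ V _ j am Axj.
- by [].
- by apply: filterS yi => y.
- by apply: cvg_row_mx; [apply: (@cvg_cst _ (mxvec (\val a)))|exact: yx].
- by split; [exact: Hj|exact: Hc].
Qed.

End Variety.

End VarietyTopology.

(** * Convergence of the powers of one element *)

Section Dynamics.
Variables (R : realType) (n : nat) (GC : set 'M[R[i]]_n) (V : atlas R[i])
  (act : 'M[R[i]]_n -> V -> V).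
Hypotheses (V_variety : variety V) (act_alg : algebraic_action GC act).

Lemma euclidean_fixpoint (f : euclidean V -> euclidean V) (w : euclidean V) :
  continuous f -> closure [set y | f y = y] w -> f w = w.
Proof.
move=> fc wf; apply: (euclidean_hausdorff V_variety) => A B fA wB.
have wfA : nbhs w (f @^-1` A) := fc w _ fA.
have [y [fy [Ay By]]] := wf _ (filterI wfA wB).
by exists y; split=> //; rewrite -fy.
Qed.

(** The limit is any cluster point w. That the orbit is eventually in a chart
around w, and that its coordinates come close to those of w, are polynomial
conditions on the entries of A ^+ k which hold infinitely often. *)
Lemma power_orbit_cvg (A : 'M[R]_n) (K : set (euclidean V)) (x : euclidean V) :
    (forall k, GC (complex_mx (A ^+ k))) ->
    (forall i j, posrec (fun k => (A ^+ k) i j)) ->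
    compact K -> (forall k, K (act (complex_mx (A ^+ k)) x)) ->
  exists2 w, K w &
    (act (complex_mx (A ^+ k)) x : euclidean V) @[k --> \oo] --> (w : euclidean V).
Proof.
move=> AGC Arec Kcpt yK; pose y k : euclidean V := act (complex_mx (A ^+ k)) x.
have [w [Kw wy]] := Kcpt (y @ \oo) _ (@filterE _ \oo _ (y @^-1` K) yK).
exists w => //.
have freq B N : nbhs w B -> exists2 k, (N <= k)%N & B (y k).
  move=> wB; have : (y @ \oo) (y @` [set k | (N <= k)%N]) by exists N => // k; exists k.
  by move=> /wy /(_ wB) [_ [[k Nk <-] Byk]]; exists k.
have [_ _ am] := act_alg.
have [i wi] := chart_cover V_variety w; have [i0 xi0] := chart_cover V_variety x.
apply/(euclidean_cvgP V_variety _ _ wi).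
pose p k : prod_atlas (mx_atlas GC) V :=
  (exist _ (complex_mx (A ^+ k)) (mem_set (AGC k)), x).
pose c k : 'rV_(n * n + Defs.dim i0) := row_mx (mxvec (complex_mx (A ^+ k))) (coords i0 x).
have crec l : cposrec (fun k => c k 0 l).
  rewrite /c; under eq_fun do rewrite mxE.
  case: (fintype.split l) => m; last exact: cposrec_cst.
  case/mxvec_indexP: m => a b; under eq_fun do rewrite mxvecE mxE.
  exact/cposrec_real/Arec.
have [Uo freg] := am i.
(* One point of the orbit in the chart provides the polynomials. *)
have [k0 _ [yk0 _]] := freq _ 0%N (euclidean_chart_nbhs V_variety wi filterT).
have yi : \forall k \near \oo, dom i (y k).
  have [I IE] := Uo (tt, i0).
  have [P IP Pk0] : exists2 P, I P & peval P (c k0) != 0.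
    apply: contrapT => nI.
    have : (@dom _ (prod_atlas (mx_atlas GC) V) (tt, i0) `&`
        ~` ((fun q => act (\val q.1) q.2) @^-1` dom i)) (p k0).
      rewrite IE; split=> // P IP; apply: contrapT => PX; apply: nI; exists P => //.
      exact/eqP.
    by case.
  have := cposrec_neq0 (cposrec_peval P crec) Pk0; apply: filterS => k Pk.
  apply: contrapT => nk.
  have : (@dom _ (prod_atlas (mx_atlas GC) V) (tt, i0) `&`
      ~` ((fun q => act (\val q.1) q.2) @^-1` dom i)) (p k) by [].
  by rewrite IE => -[_ /(_ _ IP)]; apply/eqP.
split=> //; apply: cvg_mx => a l; rewrite (ord1 a).
have [P [Q [Qk0 PQ]]] := freg (tt, i0) l (p k0) (conj (conj I xi0) yk0).
have Qk : \forall k \near \oo, peval Q (c k) != 0.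
  exact: cposrec_neq0 (cposrec_peval Q crec) Qk0.
have yE k : dom i (y k) -> peval Q (c k) != 0 ->
    coords i (y k) 0 l = peval P (c k) / peval Q (c k).
  by move=> yk Q0; exact: (PQ (p k) (conj (conj I xi0) yk) Q0).
set z := coords i w 0 l.
apply/cvgrPdist_le => e e0.
(* The bound e is a positive element of the complex field, hence real. *)
have eE : real_complex R (complex.Re e) = e by apply: RRe_real; exact: gtr0_real.
have distE k : dom i (y k) -> peval Q (c k) != 0 ->
    (`|z - coords i (y k) 0 l| <= e) =
    (`|z * peval Q (c k) - peval P (c k)| <= e * `|peval Q (c k)|).
  move=> yk Q0; rewrite yE // -ler_pdivrMr ?normr_gt0 // -normrV ?unitfE //.
  by rewrite -normrM mulrBl mulfK.
have [N _ NQ] := filterI yi Qk.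
have : \forall k \near \oo,
    `|z * peval Q (c k) - peval P (c k)| <= e * `|peval Q (c k)|.
  rewrite -eE; apply: cposrec_dominated.
  - by rewrite -ltcR eE.
  - apply: cposrecD; first exact: cposrecM (cposrec_cst _) (cposrec_peval _ _).
    under eq_fun do rewrite -mulN1r.
    exact: cposrecM (cposrec_cst _) (cposrec_peval _ _).
  - exact: cposrec_peval.
  - move=> N'; have ze : nbhs (coords i w) [set u : 'rV_(Defs.dim i) | `|z - u 0 l| <= e].
      by have /cvgrPdist_le/(_ e e0) := @coord_continuous R[i] _ _ 0 l (coords i w).
    have [k kN [yk ek]] := freq _ (maxn N N') (euclidean_chart_nbhs V_variety wi ze).
    exists k; first exact: leq_trans (leq_maxr _ _) kN.
    by rewrite eE -distE //; have [] := NQ k (leq_trans (leq_maxl _ _) kN).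
move=> H; near=> k; rewrite distE; [near: k|near: k|near: k] => //.
Unshelve. all: by end_near. Qed.

End Dynamics.

(** * Derived subgroups and common fixed points *)

Section DerivedSubgroup.
Variables (K : fieldType) (n : nat).
Implicit Types (H M G : set 'M[K]_n) (A B : 'M[K]_n).

Lemma invmx_uniq A B : A *m B = 1%:M -> invmx A = B.
Proof. by move=> AB; have [uA _] := mulmx1_unit AB; rewrite -[LHS]mulmx1 -AB mulKmx. Qed.

Definition conjmx A B : 'M[K]_n := B *m A *m invmx B.

Lemma conjmxM A A' B : B \in unitmx ->
  conjmx (A *m A') B = conjmx A B *m conjmx A' B.
Proof. by move=> uB; rewrite /conjmx !mulmxA mulmxKV. Qed.

Lemma conjmxV A B : B \in unitmx -> A \in unitmx ->
  conjmx (invmx A) B = invmx (conjmx A B).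
Proof.
move=> uB uA; apply/esym/invmx_uniq.
by rewrite -conjmxM // mulmxV // /conjmx mulmx1 mulmxV.
Qed.

Lemma unitmx_subgroup : mx_subgroup [set A : 'M[K]_n | A \in unitmx].
Proof.
split=> //=; first exact: unitmx1.
- by move=> A B /= uA uB; rewrite unitmx_mul uA.
- by move=> A /=; rewrite unitmx_inv.
Qed.

Lemma derived_subgroup H : mx_subgroup H -> mx_subgroup (derived_mx_subgroup H).
Proof.
move=> [Hu H1 HM HV]; split.
- apply: smallest_sub; first exact: unitmx_subgroup.
  by move=> _ [A [B [/Hu uA /Hu uB ->]]] /=; rewrite !unitmx_mul !unitmx_inv uA uB.
- by move=> X [[_ X1 _ _] _].
- by move=> A B DA DB X XP; have [[_ _ XM _] _] := XP; apply: XM; [exact: DA|exact: DB].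
- by move=> A DA X XP; have [[_ _ _ XV] _] := XP; apply: XV; exact: DA.
Qed.

Lemma derived_sub H : mx_subgroup H -> derived_mx_subgroup H `<=` H.
Proof.
move=> Hgrp; apply: smallest_sub => //; have [_ _ HM HV] := Hgrp.
move=> _ [A [B [HA HB ->]]].
exact: (HM _ _ (HM _ _ (HM _ _ HA HB) (HV _ HA)) (HV _ HB)).
Qed.

Definition normalized_by G H : Prop :=
  forall A B, H A -> G B -> H (conjmx A B).

(** The elements of the derived subgroup whose conjugates by B stay in it form
a subgroup containing the commutators. *)
Lemma derived_normalized G H : G `<=` [set A | A \in unitmx] -> mx_subgroup H ->
  normalized_by G H -> normalized_by G (derived_mx_subgroup H).
Proof.
move=> Gu Hgrp nH A B DA GB; have uB := Gu _ GB.
have [Hu _ _ _] := Hgrp; have [Du D1 DM DV] := derived_subgroup Hgrp.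
have /(_ A DA) [] // : derived_mx_subgroup H `<=`
  [set A | derived_mx_subgroup H A /\ derived_mx_subgroup H (conjmx A B)].
apply: smallest_sub; first split=> [C [/Du]|| C C' [DC nC] [DC' nC']|C [DC nC]] //.
- by split=> //; rewrite /conjmx mulmx1 mulmxV.
- by split; [exact: DM|rewrite conjmxM //; exact: DM].
- by split; [exact: DV|rewrite conjmxV //; [exact: DV|exact: Du]].
move=> _ [C [C' [HC HC' ->]]]; split; apply: sub_gen_smallest; first by exists C, C'.
exists (conjmx C B), (conjmx C' B); split; [exact: nH|exact: nH|].
by rewrite !conjmxM // !conjmxV //; exact: Hu.
Qed.

Lemma derived_series G k : mx_subgroup G ->
  [/\ mx_subgroup (iter k (@derived_mx_subgroup K n) G),
    iter k (@derived_mx_subgroup K n) G `<=` G &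
    normalized_by G (iter k (@derived_mx_subgroup K n) G)].
Proof.
move=> Ggrp; have [Gu _ GM GV] := Ggrp.
elim: k => [|k [IHg IHs IHn]] /=.
  by split=> // A B GA GB; exact: (GM _ _ (GM _ _ GB GA) (GV _ GB)).
split; first exact: derived_subgroup.
- exact: subset_trans (derived_sub IHg) IHs.
- exact: derived_normalized.
Qed.

End DerivedSubgroup.

Section FixedPoints.
Variables (R : realType) (n : nat) (GC : set 'M[R[i]]_n) (V : atlas R[i])
  (act : 'M[R[i]]_n -> V -> V) (G : set 'M[R]_n) (v : V).
Hypotheses (V_variety : variety V) (act_alg : algebraic_action GC act)
  (G_group : mx_subgroup G) (G_GC : forall A, G A -> GC (complex_mx A))
  (G_rec : forall A, G A -> forall i j, posrec (fun k => (A ^+ k) i j))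
  (K_compact : @compact (euclidean V) (action_orbit act G v)).

Local Notation K := (action_orbit act G v).
Local Notation rho A := (act (complex_mx A)).

Definition acts_trivially (M : set 'M[R]_n) : Prop :=
  forall A x, M A -> K x -> rho A x = x.

Lemma rhoM A B x : G A -> G B -> rho (A *m B) x = rho A (rho B x).
Proof.
have [_ actM _] := act_alg => GA GB.
by rewrite -actM ?[complex_mx _]map_mxM //; exact: G_GC.
Qed.

Lemma rho1 x : rho 1%:M x = x.
Proof. by have [act1 _ _] := act_alg; rewrite [complex_mx _]map_mx1 act1. Qed.

Lemma rho_orbit A x : G A -> K x -> K (rho A x).
Proof.
have [_ _ GM _] := G_group.
by move=> GA [B GB <-]; exists (A *m B); [exact: GM|rewrite rhoM].
Qed.

Lemma rho_continuous A : G A -> continuous (rho A : euclidean V -> euclidean V).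
Proof.
by move=> /G_GC; exact: (euclidean_action_continuous V_variety act_alg).
Qed.

Section NormalSubgroup.
Variables (M : set 'M[R]_n).
Hypotheses (M_group : mx_subgroup M) (MG : M `<=` G) (M_normal : normalized_by G M)
  (M'_trivial : acts_trivially (derived_mx_subgroup M)).

Lemma subgroup_pow A k : M A -> M (A ^+ k).
Proof.
have [_ M1 MM _] := M_group => MA.
by elim: k => [|k IH]; [rewrite expr0|rewrite exprS -mulmxE; exact: MM].
Qed.

(** A B and B A differ by a commutator, which acts trivially. *)
Lemma rho_comm A B x : M A -> M B -> K x -> rho A (rho B x) = rho B (rho A x).
Proof.
move=> MA MB Kx; have [Mu _ MM MV] := M_group.
pose c := invmx A *m invmx B *m invmx (invmx A) *m invmx (invmx B).
have Dc : derived_mx_subgroup M c.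
  by apply: sub_gen_smallest; exists (invmx A), (invmx B); split=> //; exact: MV.
have ABc : A *m B = B *m A *m c.
  rewrite /c !invmxK !mulmxA (mulmxK (Mu _ MA)) (mulmxV (Mu _ MB)) mul1mx //.
have Gc : G c by apply/MG/(derived_sub M_group).
have [GA GB] := (MG MA, MG MB).
rewrite -rhoM // ABc rhoM //; last by apply/MG; exact: MM.
by rewrite (M'_trivial Dc Kx) rhoM.
Qed.

(** If x is fixed by the elements of l, then so is the limit of A ^+ k x, since
these elements commute with A on the orbit. *)
Lemma finite_common_fixpoint (l : seq 'M[R]_n) : (forall A, A \in l -> M A) ->
  exists2 w, K w & forall A, A \in l -> rho A w = w.
Proof.
have [_ G1 _ _] := G_group.
elim: l => [|A l IH] lM.
  by exists v => //; exists 1%:M => //; rewrite rho1.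
have [x Kx xl] := IH (fun B Bl => lM B (mem_behead (s := A :: l) Bl)).
have MA : M A by apply: lM; rewrite mem_head.
have GA k : G (A ^+ k) by apply/MG/subgroup_pow.
have [w Kw xw] := power_orbit_cvg V_variety act_alg (fun k => G_GC (GA k))
  (G_rec (MG MA)) K_compact (fun k => rho_orbit (GA k) Kx).
have lim_unique : hausdorff_space (euclidean V) := euclidean_hausdorff V_variety.
(* The shifted sequence A ^+ k.+1 x gives the case of A itself. *)
have lim_rho B : M B ->
    (rho B (rho (A ^+ k) x) : euclidean V) @[k --> \oo] -->
    (rho B w : euclidean V).
  by move=> MB; exact: (continuous_cvg _ (rho_continuous (MG MB) (x := w)) xw).
exists w => // B; rewrite inE => /predU1P[->|Bl].
  apply: (cvg_unique lim_unique (lim_rho A MA)).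
  rewrite (_ : (fun k => _) = fun k => rho (A ^+ k.+1) x).
    by move=> U /xw [N _ NU]; exists N => // k Nk; apply: NU; exact: leqW.
  by apply/funext => k; rewrite exprS -mulmxE rhoM //; exact: MG.
have MB : M B by apply: lM; rewrite inE Bl orbT.
apply: (cvg_unique lim_unique (lim_rho B MB)).
rewrite (_ : (fun k => _) = fun k => rho (A ^+ k) x) //.
by apply/funext => k; rewrite (rho_comm MB (subgroup_pow k MA) Kx) xl.
Qed.

(** Compactness is applied to the filter generated by the common fixed points
of finite lists; its cluster points are fixed by M because the fixed points of
each element form a closed set. *)
Lemma common_fixpoint : exists2 w, K w & forall A, M A -> rho A w = w.
Proof.
pose S (l : seq 'M[R]_n) : set (euclidean V) :=
  [set w | K w /\ forall A, A \in l -> rho A w = w].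
pose F := filter_from [set l : seq 'M[R]_n | forall A, A \in l -> M A] S.
have FF : ProperFilter F.
  apply: filter_from_proper; last first.
    by move=> l lM; have [w Kw wl] := finite_common_fixpoint lM; exists w.
  apply: filter_from_filter; first by exists [::].
  move=> l l' lM lM'; exists (l ++ l') => [A|w [Kw wl]].
    by rewrite mem_cat => /orP[/lM|/lM'].
  by split; split=> // A Al; apply: wl; rewrite mem_cat Al ?orbT.
have FK : F K by exists [::] => // w [].
have [w [Kw wF]] := K_compact FF FK; exists w => // A MA.
apply: (euclidean_fixpoint V_variety (rho_continuous (MG MA))) => B wB.
have : F (S [:: A]) by exists [:: A] => // ?; rewrite inE => /eqP ->.
move=> /wF /(_ wB) [y [[_ yA] By]]; exists y; split=> //=.
by apply: yA; rewrite mem_head.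
Qed.

(** The fixed points of a normal subgroup are permuted by G, which is
transitive on K: one fixed point is enough. *)
Lemma normal_subgroup_trivial : acts_trivially M.
Proof.
have [Gu _ GM GV] := G_group.
have [_ [B GB <-] wM] := common_fixpoint => A _ MA [C GC' <-].
pose D := B *m invmx C.
have GD : G D by apply: GM => //; exact: GV.
have GCB : G (C *m invmx B) by apply: GM => //; exact: GV.
have CE : C = C *m invmx B *m B by rewrite mulmxKV // Gu.
have ADE : A *m (C *m invmx B) = C *m invmx B *m conjmx A D.
  rewrite /conjmx (_ : invmx D = C *m invmx B); last first.
    apply: invmx_uniq.
    by rewrite mulmxA mulmxKV ?Gu // mulmxV // Gu.
  by rewrite /D !mulmxA !mulmxKV ?mulmxV ?mul1mx ?Gu.
rewrite CE rhoM // -rhoM ?ADE //; last exact: MG.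
rewrite rhoM //; last by apply: MG; exact: M_normal.
by rewrite wM //; exact: M_normal.
Qed.

End NormalSubgroup.

Lemma solvable_acts_trivially : solvable_mx_group G -> acts_trivially G.
Proof.
move=> [k kG]; suff H j : (j <= k)%N ->
    acts_trivially (iter (k - j) (@derived_mx_subgroup R n) G).
  by have := H k (leqnn k); rewrite subnn.
elim: j => [_|j IH jk]; first by rewrite subn0 kG => A x ->; rewrite rho1.
have [Mg MG Mn] := derived_series (k - j.+1) G_group.
apply: (normal_subgroup_trivial Mg MG Mn).
by have := IH (ltnW jk); rewrite -(subnSK jk).
Qed.

End FixedPoints.

(** Both groups are generated by exponentials, and the complexified Lie algebra
contains the real one. *)
Lemma complexification_sub (R : realType) n (G : set 'M[R]_n) (GC : set 'M[R[i]]_n) :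
    connected_lie_subgroup idfun G -> complexification G GC ->
  forall A, G A -> GC (complex_mx A).
Proof.
move=> [[Gu _ _ _] [lie0 _ _ _] GE] [[[GCu GC1 GCM GCV] _ _] lieGC].
suff : G `<=` [set A | A \in unitmx /\ GC (complex_mx A)] by move=> H A /H [].
rewrite {1}GE; apply: smallest_sub.
- split=> [A []//||A B [uA GA] [uB GB]|A [uA GA]] //=.
  + by rewrite unitmx1 [complex_mx _]map_mx1.
  + by rewrite unitmx_mul uA uB [complex_mx _]map_mxM; split=> //; exact: GCM.
  + by rewrite unitmx_inv uA [complex_mx _]map_invmx; split=> //; exact: GCV.
- move=> _ [X lX <-]; split.
    by apply: Gu; have := lX 1; rewrite scale1r.
  rewrite -mexp_complex; have : lie_algebra (real_complex R) GC (complex_mx X).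
    rewrite lieGC; exists X, 0; split=> //.
    by rewrite [complex_mx 0]map_mx0 scaler0 addr0.
  by move=> /(_ 1); rewrite rmorph1 scale1r.
Qed.

Theorem proposition7 (R : realType) (n : nat) (G : set 'M[R]_n)
    (GC : set 'M[R[i]]_n) (V : atlas R[i])
    (act : 'M[R[i]]_n -> V -> V) (v : V)
    (G_alg : real_algebraic_group G)
    (G_sol : solvable_mx_group G)
    (G_real : forall (A : 'M[R]_n) (a : R[i]),
        G A -> eigenvalue (complex_mx A) a -> a \is Num.real)
    (GC_complexif : complexification G GC)
    (V_variety : variety V)
    (act_alg : algebraic_action GC act)
    (orbit_compact : @compact (euclidean V) (action_orbit act G v)) :
  exists x : V, action_orbit act G v = [set x].
Proof.
have [G_lie _] := G_alg; have [G_group _ _] := G_lie.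
have [Gu G1 _ _] := G_group.
have G_rec A : G A -> forall i j, posrec (fun k => (A ^+ k) i j).
  move=> GA; have [g [gc gG g0 g1]] := connected_lie_subgroup_path G_lie GA.
  have [t|t a|s s0 sE] := @positive_spectrum _ _ g gc g0 _ _ 1.
  - exact: Gu.
  - exact: G_real.
  - by rewrite g1 in sE; exact: pow_posrec sE.
have G_triv := solvable_acts_trivially V_variety act_alg G_group
  (complexification_sub G_lie GC_complexif) G_rec orbit_compact G_sol.
have Kv : action_orbit act G v v.
  by exists 1%:M => //; rewrite [complex_mx _]map_mx1; have [act1 _ _] := act_alg.
exists v; apply/seteqP; split=> [_ [A GA <-]|_ ->] //.
exact: G_triv.
Qed.
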